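(* Let $T=(\Omega,(\Pi_i,t_i)_{i\in N})$ be an information structure. Then exactly one of the following two statements holds: (1) $T$ admits a universal common prior; (2) there exists a weakly agreeable trade over $T$.
   Context: $\Omega$ is a finite nonempty set of states, $N=\{1,\dots,n\}$ is a finite nonempty set of players, and $\Delta(\Omega)$ is the set of probability measures on $\Omega$ (all subsets measurable). An information structure is a tuple $T=(\Omega,(\Pi_i,t_i)_{i\in N})$ where, for each $i$, $\Pi_i$ is a partition of $\Omega$ and $t_i\colon\Omega\to\Delta(\Omega)$ satisfies $t_i(\omega)(\pi_i(\omega))=1$ for every $\omega$, where $\pi_i(\omega)$ is the element of $\Pi_i$ containing $\omega$, and $t_i$ is constant on each element of $\Pi_i$. A prior of player $i$ is a $p\in\Delta(\Omega)$ such that $p(E\cap\pi)=t_i(\omega)(E)\,p(\pi)$ for all $E\subseteq\Omega$, $\pi\in\Pi_i$, $\omega\in\pi$; a common prior is a $p\in\Delta(\Omega)$ that is a prior of every player. A nonempty set $S\subseteq\Omega$ is a common certainty component if for every $\omega\in S$ and $i\in N$ there is $E\subseteq S$ with $t_i(\omega)(E)=1$. $T$ admits a universal common prior if there is a common prior $p$ with $p(S)>0$ for every common certainty component $S$. An event $E\subseteq\Omega$ is commonly certain at $\omega$ if there is a common certainty component $S$ with $\omega\in S\subseteq E$. A trade is a family $f=(f_i)_{i\in N}$ of functions $f_i\colon\Omega\to\mathbb{R}$ with $\sum_{i\in N}f_i(\omega)\le 0$ for all $\omega\in\Omega$. A trade $f$ is weakly agreeable if there exists a state $\omega\in\Omega$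 at which the event $\{\omega'\in\Omega:\int f_i\,\mathrm{d}t_i(\omega')>0 \text{ for all } i\in N\}$ is commonly certain. *)

(* Defs.v *)
From HB Require Import structures.
From mathcomp Require Import all_boot all_order all_algebra.
From mathcomp Require Import reals.

Set Implicit Arguments.
Unset Strict Implicit.
Unset Printing Implicit Defensive.

Import Order.TTheory GRing.Theory Num.Theory.
Local Open Scope ring_scope.

(* Omega is finite and every subset is measurable, so a probability measure is
   encoded by its mass function. *)
Record fdist (R : realType) (Omega : finType) := FDist {
  mass :> {ffun Omega -> R};
  massP : [forall w, 0 <= mass w] && (\sum_w mass w == 1)
}.

HB.instance Definition _ (R : realType) (Omega : finType) :=
  [isSub for @mass R Omega].

Section InformationStructures.
Variables (R : realType) (Omega : finType) (n : nat).

Definition Pr (p : fdist R Omega) (E : {set Omega}) : R := \sum_(w in E) p w.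

Definition integral (p : fdist R Omega) (f : Omega -> R) : R :=
  \sum_w p w * f w.

(* [pblock (Pi i) w] is the element of the partition [Pi i] containing [w]. *)
Record info_structure := InfoStructure {
  Pi : 'I_n -> {set {set Omega}};
  belief : 'I_n -> Omega -> fdist R Omega;
  Pi_partition : forall i, partition (Pi i) [set: Omega];
  belief_certain : forall i w, Pr (belief i w) (pblock (Pi i) w) = 1;
  belief_const : forall i (B : {set Omega}), B \in Pi i ->
    forall w w', w \in B -> w' \in B -> belief i w = belief i w'
}.

Variable T : info_structure.

Definition prior (i : 'I_n) (p : fdist R Omega) : Prop :=
  forall (E B : {set Omega}) (w : Omega), B \in Pi T i -> w \in B ->
    Pr p (E :&: B) = Pr (belief T i w) E * Pr p B.

Definition common_prior (p : fdist R Omega) : Prop := forall i, prior i p.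

Definition common_certainty_component (S : {set Omega}) : Prop :=
  S != set0 /\
  forall w, w \in S -> forall i,
    exists2 E : {set Omega}, E \subset S & Pr (belief T i w) E = 1.

Definition admits_universal_common_prior : Prop :=
  exists2 p : fdist R Omega, common_prior p &
    forall S, common_certainty_component S -> 0 < Pr p S.

Definition commonly_certain (E : {set Omega}) (w : Omega) : Prop :=
  exists S, [/\ common_certainty_component S, w \in S & S \subset E].

Definition trade (f : 'I_n -> Omega -> R) : Prop :=
  forall w, \sum_i f i w <= 0.

Definition weakly_agreeable (f : 'I_n -> Omega -> R) : Prop :=
  exists w, commonly_certain
    [set w' | [forall i, 0 < integral (belief T i w') (f i)]] w.

End InformationStructures.

(* Main.v *)
Require Import Defs.
From mathcomp Require Import all_boot all_order all_algebra.
From mathcomp Require Import boolp reals ring.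

(** Fix a common certainty component [S].  By Farkas' lemma, either some trade
    has positive expectation for every player at every state of [S], or there
    are weights [y i w >= 0] ([w] in [S]), not all zero, such that the measure
    [\sum_(w in S) y i w * t_i(w)] does not depend on [i].  A mixture of the
    types of player [i] is a prior of player [i], so this common value is, up to
    normalisation, a common prior, and it is carried by [S].  Averaging these
    common priors over all [S] gives a universal one.  Conversely, a common
    prior restricted to [S] integrates [t_i]-expectations of [f_i] to [f_i]
    itself, so a universal common prior forbids weakly agreeable trades. *)

Set Implicit Arguments.
Unset Strict Implicit.
Unset Printing Implicit Defensive.

Import Order.TTheory GRing.Theory Num.Theory.
Local Open Scope ring_scope.

(* Bartl's proof: if the first [m] functionals do not suffice, a witness [x0]
   of this satisfies [a_(m+1) x0 > 0], and one projects along [x0] onto the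
   kernel of [a_(m+1)]. *)
Lemma farkas (R : realFieldType) (V : lmodType R) (I : finType)
    (A : {set I}) (a : I -> V -> R) (b : V -> R) :
    (forall j, scalar (a j)) -> scalar b ->
    (forall x, (forall j, j \in A -> a j x <= 0) -> b x <= 0) ->
  exists2 l : I -> R, forall j, 0 <= l j &
    forall x, b x = \sum_(j in A) l j * a j x.
Proof.
move: {2}#|A| (erefl #|A|) => m; elim: m A a b => [|m IH] A a b cardA alin blin ab.
  (* With no constraint left, [b] is nonpositive at both [x] and [- x], hence zero. *)
  exists (fun=> 0) => // x; rewrite (cards0_eq cardA) big_set0.
  have nonpos y : b y <= 0 by apply: ab => j; rewrite (cards0_eq cardA) inE.
  have b0 : b 0 = 0 by have := blin (-1) 0 0; rewrite scaler0 addr0 mulN1r addNr.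
  have := nonpos (- x); have := blin (-1) x 0; rewrite b0 !addr0 scaleN1r mulN1r => ->.
  by rewrite oppr_le0 => ?; apply/eqP; rewrite eq_le nonpos.
have [k kA] : exists k, k \in A by apply/set0Pn; rewrite -card_gt0 cardA.
have cardAk : #|A :\ k| = m by move: cardA; rewrite (cardsD1 k) kA => -[].
have [abk|/existsNP[x0 /not_implyP[ax0 /negP]]] :=
    pselect (forall x, (forall j, j \in A :\ k -> a j x <= 0) -> b x <= 0).
  have [l l0 lE] := IH _ a b cardAk alin blin abk.
  exists (fun j => if j == k then 0 else l j) => [j|x]; first by case: ifP.
  rewrite (big_setD1 k)//= eqxx mul0r add0r lE; apply: eq_bigr => j.
  by rewrite !inE => /andP[/negPf ->].
rewrite -ltNge => bx0.
have akx0 : 0 < a k x0.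
  rewrite ltNge; apply/negP => akx0; move: bx0; rewrite ltNge ab// => j jA.
  by have [->//|jk] := eqVneq j k; apply: ax0; rewrite !inE jk.
(* [d f] is [f] composed with the projection [x - (a k x / a k x0) *: x0]; in particular [d (a k)]
   vanishes. *)
pose d f (x : V) : R := f x - f x0 / a k x0 * a k x.
have dlin f : scalar f -> scalar (d f).
  by move=> flin r x y; rewrite /d flin alin; ring.
have proj f x : scalar f -> d f x = f (- (a k x / a k x0) *: x0 + x).
  by move=> flin; rewrite /d flin; field; rewrite gt_eqF.
have [|l l0 lE] :=
    IH _ (d \o a) (d b) cardAk (fun j => dlin _ (alin j)) (dlin _ blin).
  move=> x dx; rewrite proj//; apply: ab => j jA.
  have [->|jk] := eqVneq j k.
    by rewrite -proj// /d divff ?gt_eqF// mul1r subrr.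
  by rewrite -proj//; apply: dx; rewrite !inE jk.
(* This value is forced by evaluating the desired identity at [x0]. It is nonnegative because
   [b x0 > 0] while the other [a j x0] are nonpositive. *)
pose lk := (b x0 - \sum_(j in A :\ k) l j * a j x0) / a k x0.
exists (fun j => if j == k then lk else l j) => [j|x].
  case: ifP => // _; apply: divr_ge0 (ltW akx0); rewrite subr_ge0.
  by apply: le_trans (ltW bx0); apply: sumr_le0 => i iA; rewrite mulr_ge0_le0// ax0.
rewrite (big_setD1 k)//= eqxx.
transitivity (lk * a k x + \sum_(j in A :\ k) l j * a j x); last first.
  by congr (_ + _); apply: eq_bigr => j; rewrite !inE => /andP[/negPf ->].
have : d b x = \sum_(j in A :\ k) l j * a j x -
    (\sum_(j in A :\ k) l j * a j x0) * (a k x / a k x0).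
  rewrite lE mulr_suml -sumrB; apply: eq_bigr => j _; rewrite /d /=.
  by field; rewrite gt_eqF.
rewrite /d /lk => /eqP; rewrite subr_eq => /eqP ->.
by field; rewrite gt_eqF.
Qed.

(** * Probability measures on a finite set *)

Section FiniteDistributions.
Variables (R : realType) (Omega : finType).
Implicit Types (p : fdist R Omega) (A E : {set Omega}).

Lemma mass_ge0 p w : 0 <= p w.
Proof. by have /andP[/forallP] := massP p. Qed.

Lemma mass_sum1 p : \sum_w p w = 1.
Proof. by have /andP[_ /eqP] := massP p. Qed.

Lemma Pr_setT p : Pr p setT = 1.
Proof. by rewrite -(mass_sum1 p); apply: eq_bigl => w; rewrite inE. Qed.

Lemma mass_out p A w : Pr p A = 1 -> w \notin A -> p w = 0.
Proof.
move=> pA wA; have := mass_sum1 p; rewrite (bigID (mem A))/= -/(Pr p A) pA.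
move=> /eqP; rewrite -subr_eq0 addrAC subrr add0r => /eqP pAC.
by apply: (psumr_eq0P _ pAC) => // v _; apply: mass_ge0.
Qed.

Lemma Pr_setIr p A E : Pr p A = 1 -> Pr p (E :&: A) = Pr p E.
Proof.
move=> pA; rewrite /Pr [RHS](big_setID A) /= [X in _ + X]big1 ?addr0// => w.
by rewrite !inE => /andP[/(mass_out pA)].
Qed.

Lemma Pr_sub1 p A E : E \subset A -> Pr p E = 1 -> Pr p A = 1.
Proof. by move=> /setIidPr EA pE; rewrite -(Pr_setIr A pE) EA. Qed.

Lemma Pr_comb p (K : finType) (c : K -> R) (q : K -> fdist R Omega) :
    (forall w, p w = \sum_k c k * q k w) ->
  forall E, Pr p E = \sum_k c k * Pr (q k) E.
Proof.
move=> pE E; rewrite /Pr (eq_bigr _ (fun w _ => pE w)) exchange_big/=.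
by apply: eq_bigr => k _; rewrite mulr_sumr.
Qed.

Lemma fdist_of (g : Omega -> R) :
    (forall w, 0 <= g w) -> \sum_w g w = 1 ->
  exists p : fdist R Omega, forall w, p w = g w.
Proof.
move=> g0 g1.
have gP : [forall w, 0 <= [ffun w => g w] w] && (\sum_w [ffun w => g w] w == 1).
  apply/andP; split; first by apply/forallP => w; rewrite ffunE.
  by rewrite -g1; apply/eqP/eq_bigr => w _; rewrite ffunE.
by exists (FDist gP) => w /=; rewrite ffunE.
Qed.

End FiniteDistributions.

(** * Types, partition blocks and priors *)

Section Priors.
Variables (R : realType) (Omega : finType) (n : nat).
Variable T : info_structure R Omega n.
Implicit Types (p : fdist R Omega) (S : {set Omega}).

Lemma in_pblock i w : w \in pblock (Pi T i) w.
Proof. by rewrite mem_pblock (cover_partition (Pi_partition T i)) inE. Qed.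

Lemma pblock_in i w : pblock (Pi T i) w \in Pi T i.
Proof. by rewrite pblock_mem// (cover_partition (Pi_partition T i)) inE. Qed.

Lemma pblock_block i B w : B \in Pi T i -> w \in B -> pblock (Pi T i) w = B.
Proof. by case/and3P: (Pi_partition T i) => _ tI _; apply: def_pblock. Qed.

Lemma belief_out i w v : v \notin pblock (Pi T i) w -> belief T i w v = 0.
Proof. exact: mass_out (belief_certain T i w). Qed.

(** The type at [w] is carried by the block of [w], and distinct blocks are disjoint. *)
Lemma Pr_belief_setI i w E B : B \in Pi T i ->
  Pr (belief T i w) (E :&: B) = (w \in B)%:R * Pr (belief T i w) E.
Proof.
move=> BPi; case: (boolP (w \in B)) => wB; rewrite (mul0r, mul1r).
  by apply: Pr_setIr; rewrite -(pblock_block BPi wB) belief_certain.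
rewrite /Pr big1// => v; rewrite inE => /andP[_ vB]; apply: belief_out.
apply: contra wB => vw; rewrite -(pblock_block BPi vB).
by rewrite (pblock_block (pblock_in i w) vw) in_pblock.
Qed.

(** Inside a block [B] only the terms with [w] in [B] survive, and their types all coincide; so this
    one type factors out, leaving the sum of [c] over [B], which is [Pr p B]. *)
Lemma mixture_prior i p (c : Omega -> R) :
  (forall v, p v = \sum_w c w * belief T i w v) -> prior T i p.
Proof.
move=> pE E B w BPi wB; rewrite -[in Pr p B](setTI B) !(Pr_comb pE) mulr_sumr.
apply: eq_bigr => u _; rewrite !Pr_belief_setI// Pr_setT.
case: (boolP (u \in B)) => uB; last by rewrite !mul0r !mulr0.
by rewrite (belief_const BPi uB wB) !mul1r mulr1 mulrC.
Qed.

(** For fixed types, the prior equation is linear in [p]. *)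
Lemma common_prior_comb p (K : finType) (c : K -> R) (q : K -> fdist R Omega) :
    (forall w, p w = \sum_k c k * q k w) -> (forall k, common_prior T (q k)) ->
  common_prior T p.
Proof.
move=> pE qc i E B w BPi wB; rewrite !(Pr_comb pE) mulr_sumr.
by apply: eq_bigr => k _; rewrite (qc k i E B w)//; ring.
Qed.

(** * Common priors against weakly agreeable trades *)

Lemma component_belief S i w : common_certainty_component T S -> w \in S ->
  Pr (belief T i w) S = 1.
Proof. by move=> [_ Sc] wS; have [E ES] := Sc w wS i; apply: Pr_sub1. Qed.

(** Compare the coefficients of [g v]. Only states [w] of [S] in the block [B] of [v] contribute on
    the left, giving [belief T i v v * Pr p (S :&: B)]. For [v] in [S], the prior equation for the
    events [S] and [[set v]] turns this into [p v]. *)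
Lemma integral_component S i p (g : Omega -> R) :
    common_certainty_component T S -> prior T i p ->
  \sum_(w in S) p w * integral (belief T i w) g = \sum_(w in S) p w * g w.
Proof.
move=> Sc pp; rewrite [RHS]big_mkcond/=.
under eq_bigr do rewrite mulr_sumr.
rewrite exchange_big; apply: eq_bigr => v _ /=.
have zero w : w \in S -> v \notin S -> belief T i w v = 0.
  by move=> wS; apply: mass_out (component_belief i Sc wS).
case: ifPn => vS; last first.
  by rewrite big1// => w wS; rewrite zero// mul0r mulr0.
set B := pblock (Pi T i) v; have vB : v \in B := in_pblock i v.
have BPi : B \in Pi T i := pblock_in i v.
have -> : p v = belief T i v v * Pr p B.
  have := pp [set v] B v BPi vB; rewrite /Pr big_set1 => <-.
  by rewrite (setIidPl _) ?sub1set// big_set1.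
have -> : Pr p B = Pr p (S :&: B).
  by rewrite (pp S B v)// component_belief// mul1r.
rewrite (big_setID B)/= [X in _ + X]big1 ?addr0 => [|w]; last first.
  rewrite inE => /andP[wB _]; rewrite belief_out ?mul0r ?mulr0//.
  apply: contra wB => vw; rewrite /B.
  by rewrite (pblock_block (pblock_in i w) vw) in_pblock.
rewrite [RHS]mulrAC -[RHS]mulrC [in RHS]/Pr mulr_suml.
apply: eq_bigr => w; rewrite inE => /andP[_ wB].
by rewrite (belief_const BPi wB vB).
Qed.

(** The [p]-integral over [S] of the sum of all [f i] is positive player by player, as [Pr p S > 0],
    but nonpositive state by state. *)
Lemma universal_prior_not_agreeable (f : 'I_n -> Omega -> R) : (0 < n)%N ->
  admits_universal_common_prior T -> trade f -> ~ weakly_agreeable T f.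
Proof.
move=> n_gt0 [p pc pS] ft [w [S [Sc _ Sf]]].
have exp_gt0 i v : v \in S -> 0 < integral (belief T i v) (f i).
  by move=> /(subsetP Sf); rewrite inE => /forallP.
have : 0 < \sum_(i < n) \sum_(v in S) p v * f i v.
  have pos i : 0 < \sum_(v in S) p v * f i v.
    have ge0 v : v \in S -> 0 <= p v * integral (belief T i v) (f i).
      by move=> vS; rewrite mulr_ge0 ?mass_ge0 ?ltW ?exp_gt0.
    rewrite -(integral_component _ Sc (pc i)) lt0r sumr_ge0// andbT psumr_neq0//.
    have /lt0r_neq0 := pS _ Sc; rewrite psumr_neq0 => [|v _]; last exact: mass_ge0.
    move=> /hasP[v vE /andP[vS pv]]; apply/hasP; exists v => //.
    by rewrite vS mulr_gt0 ?exp_gt0.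
  by rewrite (bigD1 (Ordinal n_gt0))//= ltr_wpDr// sumr_ge0// => i _; apply: ltW.
rewrite exchange_big ltNge sumr_le0// => v _.
by rewrite -mulr_sumr mulr_ge0_le0 ?mass_ge0.
Qed.

(** * A trade or a common prior, by Farkas' lemma *)

Lemma trade_or_prior S : (0 < n)%N -> common_certainty_component T S ->
  (exists2 f : 'I_n -> Omega -> R, trade f & weakly_agreeable T f) \/
  exists2 p, common_prior T p & 0 < Pr p S.
Proof.
move=> n_gt0 Sc.
(* The coordinate [None] is a slack variable [s]; the constraints read
   [s <= E_(t_i(w)) f_i] for [w] in [S] and [\sum_i f_i v <= 0], and the
   question is whether they force [s <= 0]. *)
pose V := {ffun option ('I_n * Omega) -> R^o}.
pose fof (x : V) i v : R := x (Some (i, v)).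
pose a (k : 'I_n * Omega + Omega) (x : V) : R :=
  match k with
  | inl (i, w) => x None - integral (belief T i w) (fof x i)
  | inr v => \sum_i fof x i v
  end.
pose b (x : V) : R := x None.
pose A := [set k : 'I_n * Omega + Omega | if k is inl (_, w) then w \in S else true].
have alin k : scalar (a k).
  have flin r x y i v : fof (r *: x + y) i v = r * fof x i v + fof y i v.
    by rewrite /fof !ffunE.
  move=> r x y; case: k => [[i w]|v] /=.
    have -> : integral (belief T i w) (fof (r *: x + y) i) =
        r * integral (belief T i w) (fof x i) + integral (belief T i w) (fof y i).
      rewrite /integral mulr_sumr -big_split/=.
      by apply: eq_bigr => v _; rewrite flin; ring.
    by rewrite !ffunE mulrBr opprD addrACA.
  rewrite mulr_sumr -big_split/=.
  by apply: eq_bigr => i _; rewrite flin.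
have blin : scalar b by move=> r x y; rewrite /b !ffunE.
have [ab|/existsNP[x /not_implyP[ax /negP]]] :=
    pselect (forall x, (forall k, k \in A -> a k x <= 0) -> b x <= 0); last first.
  (* A feasible point with positive slack is a trade whose expectations on [S] are all at least that
     slack. *)
  rewrite -ltNge => bx; left; exists (fof x).
    by move=> v; apply: (ax (inr v)); rewrite inE.
  have [/set0Pn[w wS] _] := Sc; exists w, S; split=> //.
  apply/subsetP => v vS; rewrite inE; apply/forallP => i.
  apply: lt_le_trans bx _; rewrite -subr_le0.
  by apply: (ax (inl (i, v))); rewrite inE.
right; have [l l0 lE] := farkas alin blin ab.
have sumA (x : V) : b x = (\sum_i \sum_(w in S) l (inl (i, w)) * a (inl (i, w)) x)
    + \sum_v l (inr v) * a (inr v) x.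
  rewrite lE big_mkcond big_sumType/=; congr (_ + _).
    rewrite pair_big_dep /= [RHS]big_mkcond/=.
    by apply: eq_bigr => -[i w] _; rewrite inE.
  by apply: eq_bigr => v _; rewrite inE.
(* Evaluate the Farkas identity at the unit vector of coordinate [(i, v)]. The left side does not
   mention [i], so all players share one mixture. *)
have yt i v : l (inr v) = \sum_(w in S) l (inl (i, w)) * belief T i w v.
  pose x : V := [ffun k => (k == Some (i, v))%:R].
  have xN : x None = 0 by rewrite ffunE.
  have fE j u : fof x j u = ((j == i) && (u == v))%:R.
    by rewrite /fof ffunE (inj_eq Some_inj) xpair_eqE.
  have intE j w : integral (belief T j w) (fof x j) = (j == i)%:R * belief T j w v.
    rewrite /integral (bigD1 v)//= big1 ?addr0 => [|u uv].
      by rewrite fE eqxx andbT mulrC.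
    by rewrite fE (negPf uv) andbF mulr0.
  have sumE u : \sum_j fof x j u = (u == v)%:R.
    rewrite (bigD1 i)//= big1 ?addr0 => [|j ji]; first by rewrite fE eqxx.
    by rewrite fE (negPf ji).
  have := sumA x; rewrite /b xN /= (bigD1 i)//= [X in _ + X + _]big1; last first.
    by move=> j ji; rewrite big1// => w _; rewrite xN intE (negPf ji) mul0r subr0 mulr0.
  rewrite addr0 [X in _ = _ + X](bigD1 v)//= [X in _ + (_ + X)]big1; last first.
    by move=> u uv; rewrite sumE (negPf uv) mulr0.
  rewrite addr0 sumE eqxx mulr1 => /eqP; rewrite eq_sym addrC addr_eq0 => /eqP ->.
  rewrite -sumrN; apply: eq_bigr => w _.
  by rewrite xN intE eqxx mul1r sub0r mulrN opprK.
(* The unit vector of the slack coordinate shows that the weights do not all vanish. *)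
have sumy : 1 = \sum_i \sum_(w in S) l (inl (i, w)).
  pose x : V := [ffun k => (k == None)%:R].
  have xN : x None = 1 by rewrite ffunE.
  have f0 i v : fof x i v = 0 by rewrite /fof ffunE.
  rewrite -{1}xN -/(b x) sumA [X in _ + X]big1 ?addr0 => [|v _].
    apply: eq_bigr => i _; apply: eq_bigr => w _ /=; rewrite xN.
    by rewrite /integral big1 => [|v _]; rewrite ?subr0 ?mulr1// f0 mulr0.
  by rewrite /= big1 ?mulr0.
have sumz i : \sum_v l (inr v) = \sum_(w in S) l (inl (i, w)).
  under eq_bigr do rewrite (yt i).
  rewrite exchange_big; apply: eq_bigr => w _ /=.
  by rewrite -mulr_sumr mass_sum1 mulr1.
(* The [n] players have equal total weight and these totals add up to 1, so the normalising factor
   is [n]. *)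
have sumz1 : \sum_v n%:R * l (inr v) = 1 :> R.
  rewrite -mulr_sumr [RHS]sumy -(eq_bigr _ (fun i _ => sumz i)) sumr_const card_ord.
  by rewrite mulr_natl.
have [v|p pE] := fdist_of _ sumz1; first by rewrite mulr_ge0 ?ler0n.
pose c i w := (w \in S)%:R * n%:R * l (inl (i, w)).
have mix i v : p v = \sum_w c i w * belief T i w v.
  rewrite pE (yt i) mulr_sumr big_mkcond; apply: eq_bigr => w _; rewrite /c.
  by case: ifP => _; rewrite ?mul0r// mul1r mulrA.
exists p; first by move=> i; apply: mixture_prior (mix i).
(* Any one player's mixture shows this, since it involves only types at states of [S], all carried
   by [S]. *)
suff -> : Pr p S = 1 by [].
rewrite -(Pr_setT p) !(Pr_comb (mix (Ordinal n_gt0))).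
apply: eq_bigr => w _; rewrite /c Pr_setT.
case: (boolP (w \in S)) => wS; last by rewrite !mul0r.
by rewrite component_belief.
Qed.

(** * Averaging common priors *)

Lemma component_setT : (0 < #|Omega|)%N -> common_certainty_component T setT.
Proof.
move=> Omega_gt0; split; first by rewrite -card_gt0 cardsT.
by move=> w _ i; exists setT; rewrite ?Pr_setT.
Qed.

Lemma average_universal : (0 < #|Omega|)%N ->
    (forall S, common_certainty_component T S ->
      exists2 p, common_prior T p & 0 < Pr p S) ->
  admits_universal_common_prior T.
Proof.
move=> Omega_gt0 priors.
have /choice[q qP] : forall S, exists p,
    common_prior T p /\ (common_certainty_component T S -> 0 < Pr p S).
  move=> S; have [Sc|Sc] := pselect (common_certainty_component T S).
    by have [p pc pS] := priors S Sc; exists p.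
  (* A set that is no component still needs some common prior as a default; the one for the whole
     space serves. *)
  by have [p pc _] := priors _ (component_setT Omega_gt0); exists p.
(* Uniform weight over all subsets, so the prior chosen for each component enters the average with a
   positive coefficient. *)
pose c : R := #|{set Omega}|%:R^-1.
have card_gt0 : 0 < #|{set Omega}|%:R :> R.
  by rewrite ltr0n; apply/card_gt0P; exists set0.
have c_gt0 : 0 < c by rewrite invr_gt0.
have [w||p pE] := @fdist_of _ _ (fun w => \sum_S c * q S w).
- by apply: sumr_ge0 => S _; rewrite mulr_ge0 ?mass_ge0// ltW.
- rewrite exchange_big /=; under eq_bigr do rewrite -mulr_sumr mass_sum1 mulr1.
  by rewrite sumr_const -[LHS]mulr_natr mulVf ?gt_eqF.
have Pr_ge0 S E : 0 <= Pr (q S) E by apply: sumr_ge0 => w _; apply: mass_ge0.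
exists p => [|S Sc]; first by apply: common_prior_comb pE _ => S; case: (qP S).
rewrite (Pr_comb pE) (bigD1 S)//= ltr_wpDr ?mulr_gt0//; last by case: (qP S) => _; apply.
by apply: sumr_ge0 => S' _; rewrite mulr_ge0 ?Pr_ge0// ltW.
Qed.

End Priors.

Theorem theorem52 (R : realType) (Omega : finType) (n : nat)
    (Omega_gt0 : (0 < #|Omega|)%N) (n_gt0 : (0 < n)%N)
    (T : info_structure R Omega n) :
  (admits_universal_common_prior T \/
     exists2 f : 'I_n -> Omega -> R, trade f & weakly_agreeable T f) /\
  ~ (admits_universal_common_prior T /\
     exists2 f : 'I_n -> Omega -> R, trade f & weakly_agreeable T f).
Proof.
split; last first.
  by move=> [univ [f ft]]; apply: universal_prior_not_agreeable ft.
have [agree|noagree] :=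
  pselect (exists2 f : 'I_n -> Omega -> R, trade f & weakly_agreeable T f).
  by right.
left; apply: average_universal => // S Sc.
by have [|] := trade_or_prior n_gt0 Sc.
Qed.
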